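(* Let $q\ge4$ be a prime power of characteristic $p$, $A=\mathbb{F}_q[T]$. Let $\mathcal{W}^2=\{(g_1,g_2)\in A^2:g_2\neq0\}$ and let $\mathcal{S}^2\subseteq\mathcal{W}^2$ be the set of $\vec g=(g_1,g_2)$ such that $\nu_{(T)}(g_i)=0$ for $i=1,2$, and there exists a nonzero prime ideal $\mathfrak{l}\neq(T)$ of $A$ with $\nu_{\mathfrak{l}}(g_1)=0$ and $p\nmid\nu_{\mathfrak{l}}(g_2)$. Then the density of $\mathcal{S}^2$ exists and equals $\left(1-\frac1q\right)^2$.
   Context: $\nu_{\mathfrak{l}}$ is the normalized $\mathfrak{l}$-adic valuation. For $g\in A$ let $|g|=q^{\deg_T g}$ if $g\neq0$ and $|0|=0$; for $\vec g\in A^r$ let $|\vec g|=\max_i|g_i|$. For $N>0$ let $\mathcal{W}^r(N)=\{\vec g\in\mathcal{W}^r:|\vec g|<q^N\}$ and for $\mathcal{S}\subseteq\mathcal{W}^r$ let $\mathcal{S}(N)=\mathcal{S}\cap\mathcal{W}^r(N)$. The density of $\mathcal{S}$ is $\lim_{N\to\infty}|\mathcal{S}(N)|/|\mathcal{W}^r(N)|$ when the limit exists. *)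

(* Defs.v *)
From HB Require Import structures.
From mathcomp Require Import all_boot all_order all_algebra ring_quotient.
From mathcomp Require Import finmap.
From mathcomp Require Import boolp classical_sets functions cardinality.
From mathcomp Require Import reals topology normedtype sequences.

Set Implicit Arguments.
Unset Strict Implicit.
Unset Printing Implicit Defensive.

Import Order.TTheory GRing.Theory Num.Theory.
Import numFieldNormedType.Exports.

Local Open Scope classical_set_scope.
Local Open Scope ring_scope.

Section Ideals.
Variable A : comNzRingType.
Implicit Types (I J : set A) (g : A).

Definition principal_ideal g : set A := [set g * h | h in [set: A]].

(* [idealr_closed] already includes properness (1 is not in the ideal). *)
Definition prime_ideal I : Prop :=
  idealr_closed [in I] /\ prime_idealr_closed [in I].

Definition ideal_mul I J : set A :=
  [set x | exists2 s : seq (A * A),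
    (forall u, u \in s -> I u.1 /\ J u.2) & x = \sum_(u <- s) u.1 * u.2].

Fixpoint ideal_exp I (n : nat) : set A :=
  if n is m.+1 then ideal_mul I (ideal_exp I m) else [set: A].

(* The normalized I-adic valuation of g for a nonzero prime ideal I: the
   exponent n such that g lies in I^n but not in I^(n+1). [None] stands for
   +oo, which is the valuation of 0. *)
Definition ideal_val I g : option nat :=
  xget None
    [set o | exists2 n, o = Some n & ideal_exp I n g /\ ~ ideal_exp I n.+1 g].

End Ideals.

Section Density.
Variable F : finFieldType.
Local Notation A := {poly F}.
Implicit Types (g : A) (v : A * A) (S : set (A * A)) (N p : nat).

Definition absA g : nat := if g == 0 then 0%N else (#|F| ^ (size g).-1)%N.

Definition absA2 v : nat := maxn (absA v.1) (absA v.2).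

Definition W2 : set (A * A) := [set v | v.2 != 0].

Definition W2_below N : set (A * A) :=
  [set v | W2 v /\ (absA2 v < #|F| ^ N)%N].

Definition below S N : set (A * A) := S `&` W2_below N.

Definition S2 p : set (A * A) :=
  [set v | [/\ W2 v,
               ideal_val (principal_ideal 'X) v.1 = Some 0%N,
               ideal_val (principal_ideal 'X) v.2 = Some 0%N &
               exists l : set A,
                 [/\ prime_ideal l, l <> [set 0], l <> principal_ideal 'X,
                     ideal_val l v.1 = Some 0%N &
                     exists2 n, ideal_val l v.2 = Some n & ~~ (p %| n)%N]]].

(* [fset_set] returns the empty set on infinite sets; [finite_W2_below] shows
   that this default never occurs in [has_density]. *)
Lemma finite_W2_below N : finite_set (W2_below N).
Proof.
have sz g : (absA g < #|F| ^ N)%N -> (size g <= N)%N.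
  rewrite /absA; case: eqP => [->|/eqP g0]; first by rewrite size_poly0.
  rewrite ltn_exp2l; last exact: card_finNzRing_gt1.
  by rewrite prednK // size_poly_gt0.
pose f (u : 'rV[F]_N * 'rV[F]_N) : A * A := (rVpoly u.1, rVpoly u.2).
apply: (@sub_finite_set _ _ (f @` [set: 'rV[F]_N * 'rV[F]_N])).
  move=> [g h] [_]; rewrite /absA2 /= gtn_max => /andP[/sz gN /sz hN].
  by exists (poly_rV g, poly_rV h) => //; rewrite /f /= !poly_rV_K.
exact/finite_image/finite_finset.
Qed.

Definition has_density (R : realType) S (d : R) : Prop :=
  (#|` fset_set (below S N)|%:R / #|` fset_set (W2_below N)|%:R : R)
    @[N --> \oo] --> d.

End Density.

Arguments S2 F p : clear implicits.

(* Main.v *)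
Require Import Defs.
From mathcomp Require Import all_boot all_order all_algebra.
From mathcomp Require Import finmap zify ring lra.
From mathcomp Require Import boolp classical_sets cardinality.
From mathcomp Require Import reals topology normedtype sequences.

(** Pairs with both entries prime to [T] have density [(1 - 1/q)^2], so it is
    enough that those lying outside [S2] have density 0. For such a pair, every
    prime [l] with [p] not dividing [v_l(g2)] divides [g1]; hence so does the
    product [h] of these primes, which leaves a proportion [q^(- deg h)] of the
    possible [g1]. On the other hand [g2 = u k^p] with [deg u <= p deg h], so
    few [g2] have [deg h < D]: at most [q^(p D + N/p + 1)] out of [q^N]. Taking
    [D = N/(4p)] makes both contributions negligible. *)

Set Implicit Arguments.
Unset Strict Implicit.
Unset Printing Implicit Defensive.

Import Order.TTheory GRing.Theory Num.Theory.
Import numFieldNormedType.Exports.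

Local Open Scope ring_scope.

(** * Multiplicities of irreducible factors in [{poly K}] *)

Section Multiplicity.
Variable K : fieldType.
Implicit Types (g h l u k : {poly K}) (n p : nat).

(** The valuation as a relation, with no default value: for [g = 0] no [n] satisfies it, in
    agreement with [ideal_val] being [None] there. *)
Definition exact_dvdp l n g := (l ^+ n %| g) && ~~ (l ^+ n.+1 %| g).

Lemma exact_dvdp_inj l g m n : exact_dvdp l m g -> exact_dvdp l n g -> m = n.
Proof.
move=> /andP[lm lmN] /andP[ln lnN].
case: (ltngtP m n) => // mn.
  by case/negP: lmN; apply: dvdp_trans ln; exact: dvdp_exp2l.
by case/negP: lnN; apply: dvdp_trans lm; exact: dvdp_exp2l.
Qed.

Lemma exact_dvdp0 l g : exact_dvdp l 0 g = ~~ (l %| g).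
Proof. by rewrite /exact_dvdp expr0 dvd1p expr1. Qed.

Lemma exact_dvdp_exists l g : (1 < size l)%N -> g != 0 ->
  exists n, exact_dvdp l n g.
Proof.
move=> l1 g0.
have ub n : l ^+ n %| g -> (n <= size g)%N.
  move=> /dvdp_leq -/(_ g0); apply: leq_trans.
  have l0 : l != 0 by rewrite -size_poly_gt0; exact: ltn_trans l1.
  rewrite -[size (l ^+ n)]prednK; last by rewrite size_poly_gt0 expf_neq0.
  by rewrite size_exp; apply: leqW; rewrite leq_pmull // -subn1 subn_gt0.
have ex0 : exists n, l ^+ n %| g by exists 0%N; rewrite expr0 dvd1p.
case: (ex_maxnP ex0 ub) => n ln maxn; exists n; rewrite /exact_dvdp ln /=.
by apply/negP => /maxn; rewrite ltnn.
Qed.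

Lemma exact_dvdp_cofactor l n g : exact_dvdp l n g ->
  exists2 g', g = l ^+ n * g' & ~~ (l %| g').
Proof.
move=> /andP[/dvdpP[g' ->] N]; exists g'; first by rewrite mulrC.
by apply: contra N => lg'; rewrite exprS dvdp_mul.
Qed.

Lemma irreducible_dvdp_exists g : (1 < size g)%N ->
  exists2 l, irreducible_poly l & l %| g.
Proof.
have [m] := ubnP (size g); elim: m g => // m IH g gm g1.
have [irr|nirr] := pselect (irreducible_poly g); first by exists g.
have g0 : g != 0 by rewrite -size_poly_gt0; exact: ltn_trans g1.
have [d [d1 dg dNg]] : exists d : {poly K}, [/\ size d != 1%N, d %| g & ~~ (d %= g)].
  apply: contra_notP nirr => nex; split=> // d d1 dg; apply/negPn/negP => dNg.
  by apply: nex; exists d.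
have d0 : d != 0 by apply: contraNneq g0 => d0; rewrite -dvd0p -d0.
have dlt : (size d < size g)%N.
  by rewrite ltn_neqAle dvdp_leq // andbT dvdp_size_eqp.
have [|l irr ld] := IH d (leq_trans dlt gm).
  by move: d1; rewrite -size_poly_gt0 in d0; case: (size d) d0 => [|[]].
by exists l => //; exact: dvdp_trans ld dg.
Qed.

Lemma irreducible_dvdpM l g h : irreducible_poly l ->
  (l %| g * h) = (l %| g) || (l %| h).
Proof.
move=> irr; apply/idP/orP => [lgh|[lg|lh]]; last 2 first.
- exact: dvdp_mulr.
- exact: dvdp_mull.
have [lg|] := boolP (l %| g); first by left.
by rewrite -irreducible_poly_coprime // => co; right; rewrite -(Gauss_dvdpr _ co).
Qed.

(** For entries prime to ['X], this expresses through polynomials that the existential condition of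
    [S2] fails for [(g1, g)]; ['X] itself then has multiplicity 0 in [g], which [p] divides. *)
Definition covers_nondivisible p g g1 := forall l n,
  irreducible_poly l -> exact_dvdp l n g -> ~~ (p %| n)%N -> l %| g1.

(* [h] is the product of the primes [l] with [p] not dividing [v_l(g)], and
   [u] collects the powers [l ^ (v_l(g) mod p)]. *)
Lemma powerfree_decomposition p g : (0 < p)%N -> g != 0 ->
  exists h, [/\ h %| g, forall g1, covers_nondivisible p g g1 -> h %| g1 &
    exists u k, g = u * k ^+ p /\ (size u <= (p * (size h).-1).+1)%N].
Proof.
(* Induction on the size of [g]: each round strips the full power [l ^+ n] of one irreducible
   factor. *)
move=> p0; have [m] := ubnP (size g); elim: m g => // m IH g gm g0.
have [g1|g1] := leqP (size g) 1.
  exists 1; split=> [|? _|]; rewrite ?dvd1p //.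
  by exists g, 1; rewrite expr1n mulr1 size_poly1 muln0.
have [l irr lg] := irreducible_dvdp_exists g1.
have [l1 _] := irr; have l0 := irredp_neq0 irr.
have [n en] := exact_dvdp_exists l1 g0.
have [g' gE lg'] := exact_dvdp_cofactor en.
have n0 : (0 < n)%N by case: n en {gE} => //; rewrite exact_dvdp0 lg.
have g'0 : g' != 0 by apply: contraNneq g0 => g'0; rewrite gE g'0 mulr0.
have szl : size (l ^+ n) = (((size l).-1 * n).+1)%N.
  by rewrite -size_exp prednK // size_poly_gt0 expf_neq0.
have g'm : (size g' < m)%N.
  apply: (@leq_trans (size g)) => //.
  rewrite gE size_mul ?expf_neq0 // szl.
  have : (0 < (size l).-1 * n)%N by rewrite muln_gt0 n0 -subn1 subn_gt0 l1.
  by move: ((size l).-1 * n)%N (size g') => a b; clear; lia.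
have [h' [h'g' h'cov [u' [k' [g'E u'h']]]]] := IH g' g'm g'0.
(* Irreducible factors of [g'] are coprime to [l], so they have the same multiplicity in [g]. *)
have cov' g2 : covers_nondivisible p g g2 -> covers_nondivisible p g' g2.
  move=> cov l2 n2 irr2 e2 pn2; apply: (cov l2 n2) => //.
  have n20 : (0 < n2)%N by case: n2 pn2 {e2} => //; rewrite dvdn0.
  have co : coprimep l2 (l ^+ n).
    rewrite coprimep_expr // irreducible_poly_coprime //; apply/negP => l2l.
    have l2g' : l2 %| g'.
      by case/andP: e2 => + _; apply: dvdp_trans; rewrite -{1}[l2]expr1 dvdp_exp2l.
    have sz2 : size l2 != 1%N by have [] := irr2; case: (size l2) => [|[]].
    have [_ /(_ l2 sz2 l2l) e] := irr.
    by move: lg'; rewrite -(eqp_dvdl _ e) l2g'.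
  by move: e2; rewrite /exact_dvdp gE !Gauss_dvdpr // coprimep_pexpl.
have h'0 : h' != 0 by apply: contraNneq g'0 => h'0; rewrite -dvd0p -h'0.
have lh' : coprimep l h'.
  rewrite irreducible_poly_coprime //.
  by apply: contra lg' => lh'; exact: dvdp_trans h'g'.
have u'0 : u' != 0 by apply: contraNneq g'0 => u'0; rewrite g'E u'0 mul0r.
(* Euclidean division of [n] by [p]: the quotient goes into [k], the remainder into [u]. *)
have gE' : g = (l ^+ (n %% p) * u') * (l ^+ (n %/ p) * k') ^+ p.
  by rewrite exprMn -exprM mulrACA -exprD addnC -divn_eq gE g'E.
have [pn|pn] := boolP (p %| n)%N.
  exists h'; split.
  - by rewrite gE dvdp_mull.
  - by move=> g2 /cov'; exact: h'cov.
  - by exists u', (l ^+ (n %/ p) * k'); rewrite gE' (eqP pn) expr0 mul1r.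
exists (l * h'); split.
- by rewrite gE dvdp_mul // -{1}[l]expr1 dvdp_exp2l.
- move=> g2 cov; rewrite Gauss_dvdp //; apply/andP; split.
    exact: (cov l n).
  exact/h'cov/cov'.
- exists (l ^+ (n %% p) * u'), (l ^+ (n %/ p) * k'); split=> //.
  have szr : size (l ^+ (n %% p)) = (((size l).-1 * (n %% p)).+1)%N.
    by rewrite -size_exp prednK // size_poly_gt0 expf_neq0.
  rewrite !size_mul ?expf_neq0 // szr.
  (* The new factor of [u] has degree [(n %% p) * deg l], below the [p * deg l] that the factor [l]
     of [h] adds to the bound. *)
  have := ltn_pmod n p0; move: (n %% p)%N => r rp.
  move: h'0 l1 u'h' u'0; rewrite -!size_poly_gt0.
  move: (size h') (size l) (size u') => a b c; clear -rp; nia.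
Qed.

End Multiplicity.

(** * Valuations at principal ideals, read as divisibility *)

Section IdealValuation.
Variable K : fieldType.
Implicit Types (g l : {poly K}) (n : nat).

Lemma principal_idealE l g : principal_ideal l g <-> l %| g.
Proof.
split=> [[h _ <-]|/dvdpP[h ->]]; first exact: dvdp_mulr.
by exists h => //; rewrite mulrC.
Qed.

Lemma ideal_exp_principalE l n g : ideal_exp (principal_ideal l) n g <-> l ^+ n %| g.
Proof.
elim: n g => [|n IH] g /=; first by rewrite expr0 dvd1p.
split=> [[s sP ->]|/dvdpP[h ->]].
  rewrite big_seq; apply: (big_ind (fun x => l ^+ n.+1 %| x)) => [||u us].
  - exact: dvdp0.
  - by move=> ? ?; exact: dvdp_add.
  - have [/principal_idealE lu /IH lnu] := sP _ us.
    by rewrite exprS dvdp_mul.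
(* A one-term sum already reaches every multiple of [l ^+ n.+1]. *)
exists [:: (l, l ^+ n * h)]; last by rewrite big_seq1 /= mulrA -exprS mulrC.
move=> u; rewrite inE => /eqP -> /=; split; first exact/principal_idealE.
by apply/IH; rewrite dvdp_mulr.
Qed.

(** At most one exponent is exact, so the choice made by [xget] is forced, and the default [None]
    arises only when there is no such exponent. *)
Lemma ideal_val_principalE l g n :
  ideal_val (principal_ideal l) g = Some n <-> exact_dvdp l n g.
Proof.
have H k : (ideal_exp (principal_ideal l) k g /\
     ~ ideal_exp (principal_ideal l) k.+1 g) <-> exact_dvdp l k g.
  split=> [[/ideal_exp_principalE lk lkN]|/andP[lk /negP lkN]].
    by rewrite /exact_dvdp lk /=; apply/negP => /ideal_exp_principalE.
  split; first exact/ideal_exp_principalE.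
  by move=> /ideal_exp_principalE.
rewrite /ideal_val; split=> [|en].
  case: xgetP => [x _ [k -> /H ek] [<-]|//].
  exact: ek.
apply: xget_unique; first by exists n => //; exact/H.
by move=> y [k -> /H ek]; rewrite (exact_dvdp_inj ek en).
Qed.

Lemma irreducible_prime_ideal l : irreducible_poly l ->
  prime_ideal (principal_ideal l).
Proof.
move=> irr.
have inE' g : (g \in [in principal_ideal l]) = (l %| g).
  by apply/idP/idP; rewrite !inE /= => /principal_idealE.
split; first split.
- by rewrite inE' dvdp0.
- rewrite inE' dvdp1; have [] := irr; by case: (size l) => [|[]].
- by move=> a u v; rewrite !inE' => lu lv; rewrite dvdp_add // dvdp_mull.
- by move=> u v; rewrite !inE' irreducible_dvdpM.
Qed.

End IdealValuation.

(** * Membership in [S2] between two divisibility conditions *)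

Lemma S2_main_part (F : finFieldType) p v : S2 F p v ->
  ~~ ('X %| v.1) /\ ~~ ('X %| v.2).
Proof. by case=> _ /ideal_val_principalE + /ideal_val_principalE; rewrite !exact_dvdp0. Qed.

(** An irreducible [l] that violates the covering condition generates a prime ideal of the kind [S2]
    asks for. *)
Lemma S2_not_covered (F : finFieldType) p (v : {poly F} * {poly F}) :
  ~~ ('X %| v.1) -> ~~ ('X %| v.2) -> ~ covers_nondivisible p v.2 v.1 ->
  S2 F p v.
Proof.
move=> X1 X2 nc; split.
- by apply: contraNneq X2 => ->; rewrite dvdp0.
- by apply/ideal_val_principalE; rewrite exact_dvdp0.
- by apply/ideal_val_principalE; rewrite exact_dvdp0.
apply: contra_notP nc => nex l n irr en pn; apply/negPn/negP => lv1; apply: nex.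
have l0 := irredp_neq0 irr.
(* As [p] does not divide [n], [n] is positive, so [l] divides [v.2] while ['X] does not; this keeps
   the ideal of [l] apart from that of ['X]. *)
have lX : ~ 'X %| l.
  move=> Xl; case/negP: X2; apply: dvdp_trans Xl _.
  case/andP: en => + _; apply: dvdp_trans.
  by case: n pn => [|n _]; rewrite ?dvdn0 // exprS dvdp_mulr.
have ll : principal_ideal l l by exact/principal_idealE.
exists (principal_ideal l); split.
- exact: irreducible_prime_ideal.
- by move=> e; rewrite e /= in ll; rewrite ll eqxx in l0.
- by move=> e; rewrite e in ll; exact/lX/principal_idealE.
- by apply/ideal_val_principalE; rewrite exact_dvdp0.
- by exists n => //; exact/ideal_val_principalE.
Qed.

(** * Counting pairs of polynomials of bounded degree *)

Section Counting.
Variable F : finFieldType.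
Local Notation q := #|F|.
Implicit Types (g h : {poly F}) (N : nat).

Lemma rVpoly_eq0 N (v : 'rV[F]_N) : (rVpoly v == 0) = (v == 0).
Proof. by rewrite -[in RHS](can_eq rVpolyK) linear0. Qed.

Lemma size_rVpoly N (v : 'rV[F]_N) : (size (rVpoly v) <= N)%N.
Proof. exact: size_poly. Qed.

Lemma card_rV N : #|{: 'rV[F]_N}| = (q ^ N)%N.
Proof. by rewrite card_mx mul1n. Qed.

(** Rows of length [N] stand for polynomials of degree below [N]; multiplication by [h] is a
    bijection from rows of length [N - deg h] onto the multiples of [h]. *)
Lemma card_multiples_rV N h : h != 0 -> ((size h).-1 <= N)%N ->
  #|[set v : 'rV[F]_N | h %| rVpoly v]| = (q ^ (N - (size h).-1))%N.
Proof.
move=> h0 hN; set d := (size h).-1.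
have szh : size h = d.+1 by rewrite prednK // size_poly_gt0.
pose f (u : 'rV[F]_(N - d)) : 'rV[F]_N := poly_rV (h * rVpoly u).
have fE u : rVpoly (f u) = h * rVpoly u.
  rewrite poly_rV_K //; apply: leq_trans (size_polyMleq _ _) _.
  by rewrite szh addSn /= -leq_subRL // size_rVpoly.
have fI : injective f.
  move=> u v /(congr1 rVpoly); rewrite !fE => /(mulfI h0).
  exact: (can_inj rVpolyK).
rewrite -card_rV -(card_imset predT fI); apply: eq_card => v.
rewrite inE; apply/idP/imsetP => [/dvdpP[k kE]|[u _ ->]]; last first.
  by rewrite fE dvdp_mulr.
exists (poly_rV k) => //; apply: (can_inj rVpolyK); rewrite fE poly_rV_K.
  by rewrite kE mulrC.
have [->|k0] := eqVneq k 0; first by rewrite size_poly0.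
have := size_rVpoly v; rewrite kE size_mul // szh addnS /= addnC.
by rewrite leq_subRL.
Qed.

Lemma card_coprimeX_rV N : (0 < N)%N ->
  #|[set v : 'rV[F]_N | ~~ ('X %| rVpoly v)]| = (q ^ N - q ^ N.-1)%N.
Proof.
move=> N0.
have <- : ~: [set v : 'rV[F]_N | 'X %| rVpoly v] =
          [set v : 'rV[F]_N | ~~ ('X %| rVpoly v)].
  by apply/finset.setP => v; rewrite !inE.
rewrite cardsCs finset.setCK card_rV card_multiples_rV ?polyX_eq0 // size_polyX //.
by rewrite subn1.
Qed.

Definition rVpoly2 N (v : 'rV[F]_N * 'rV[F]_N) := (rVpoly v.1, rVpoly v.2).

Lemma rVpoly2_inj N : injective (@rVpoly2 N).
Proof.
move=> [a b] [c d] [/(can_inj rVpolyK) + /(can_inj rVpolyK)].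
by move=> /= -> ->.
Qed.

Lemma absA_lt g N : (absA g < q ^ N)%N = (size g <= N)%N.
Proof.
have q1 : (1 < q)%N by exact: card_finNzRing_gt1.
rewrite /absA; case: eqP => [->|/eqP g0].
  by rewrite size_poly0 expn_gt0 (ltnW q1).
by rewrite ltn_exp2l // prednK // size_poly_gt0.
Qed.

Lemma W2_belowE N (v : {poly F} * {poly F}) :
  W2_below N v <-> [/\ v.2 != 0, (size v.1 <= N)%N & (size v.2 <= N)%N].
Proof.
rewrite /W2_below /W2 /absA2 /= gtn_max !absA_lt.
by split=> [[? /andP[]]|[? -> ->]].
Qed.

(** Moves counts of classical sets to a finite type: [rVpoly2] is injective and its image contains
    [W2_below N]. *)
Lemma card_subset_W2_below N (S : set ({poly F} * {poly F})) :
  (S `<=` W2_below N)%classic ->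
  #|` fset_set S| = #|[set v : 'rV[F]_N * 'rV[F]_N | `[< S (rVpoly2 v) >]]|.
Proof.
move=> SW; set B := [set v | _].
have SE : S = (@rVpoly2 N @` [set` B])%classic.
  apply/seteqP; split=> [[g h] Sgh|_ [v /= + <-]]; last first.
    by rewrite inE => /asboolP.
  have /W2_belowE[_ /= gN hN] := SW _ Sgh.
  exists (poly_rV g, poly_rV h); last by rewrite /rVpoly2 /= !poly_rV_K.
  by rewrite /= inE; apply/asboolP; rewrite /rVpoly2 /= !poly_rV_K.
rewrite {1}SE fset_set_image; last exact: finite_finpred.
rewrite card_imfset /=; last exact: rVpoly2_inj.
rewrite -[LHS]/(#|` fset_set [set` B]%classic|) -card_finset.
congr (size (enum_fset _)); apply/fsetP => v.
rewrite in_fset_set; last exact: finite_finpred.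
by rewrite mem_setE !inE.
Qed.

Lemma card_W2_below N : #|` fset_set (@W2_below F N)| = (q ^ N * (q ^ N - 1))%N.
Proof.
rewrite (@card_subset_W2_below N) //.
have -> : [set v : 'rV[F]_N * 'rV[F]_N | `[< W2_below N (rVpoly2 v) >]] =
          finset.setX [set: _] (~: [set 0]).
  apply/finset.setP => v; rewrite !inE /= -rVpoly_eq0; apply/asboolP/idP.
    by move=> /W2_belowE[].
  by move=> v0; apply/W2_belowE; split=> //; exact: size_rVpoly.
by rewrite cardsX cardsT cardsCs finset.setCK cards1 card_rV.
Qed.

Lemma card_below_S2_le N p : (0 < N)%N ->
  (#|` fset_set (below (S2 F p) N)| <= (q ^ N - q ^ N.-1) ^ 2)%N.
Proof.
move=> N0; rewrite (@card_subset_W2_below N); last by move=> ? [].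
rewrite -card_coprimeX_rV // -mulnn -cardsX; apply/subset_leq_card/fintype.subsetP => v.
rewrite inE => /asboolP[s _]; have [X1 X2] := S2_main_part s.
by rewrite !inE X1.
Qed.

(** Each counted polynomial [u * k ^+ p] is determined by [u], of size at most [p * D], and [k], of
    degree at most [N %/ p]. *)
Lemma card_small_powerfree_part N D p (H : {poly F} -> {poly F}) : (1 < p)%N ->
  (forall g, g != 0 -> exists u k,
    g = u * k ^+ p /\ (size u <= (p * (size (H g)).-1).+1)%N) ->
  (#|[set v : 'rV[F]_N | (v != 0%R) && ((size (H (rVpoly v))).-1 < D)]|
    <= q ^ (p * D + (N %/ p).+1))%N.
Proof.
move=> p1 HP.
(* [poly_rV] truncates products that are too long; this is harmless, as the image of [f] only has to
   contain the counted rows. *)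
pose f (w : 'rV[F]_(p * D) * 'rV[F]_(N %/ p).+1) : 'rV[F]_N :=
  poly_rV (rVpoly w.1 * rVpoly w.2 ^+ p).
have -> : (q ^ (p * D + (N %/ p).+1))%N =
    #|{: 'rV[F]_(p * D) * 'rV[F]_(N %/ p).+1}|.
  by rewrite card_prod !card_rV expnD.
apply: leq_trans (leq_imset_card f _); apply/subset_leq_card/fintype.subsetP => v.
rewrite inE => /andP[v0 vD].
have g0 : rVpoly v != 0 by rewrite rVpoly_eq0.
have [u [k [gE uH]]] := HP _ g0.
have u0 : u != 0 by apply: contraNneq g0 => u0; rewrite gE u0 mul0r.
have k0 : k != 0.
  by apply: contraNneq g0 => k0; rewrite gE k0 expr0n gtn_eqF ?mulr0 // ltnW.
(* Here [p * deg k] is the degree of [k ^+ p], at most that of the product, which is below [N]. *)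
have kN : (size k <= (N %/ p).+1)%N.
  rewrite -(prednK (_ : 0 < size k)%N) ?size_poly_gt0 // ltnS leq_divRL ?(ltnW p1) //.
  rewrite -size_exp; have := size_rVpoly v; rewrite gE.
  rewrite size_mul ?expf_neq0 //; move: u0; rewrite -size_poly_gt0.
  by move: (size _) (size _) => a b; clear; lia.
(* With [d = deg (H g) < D], [p * d + 1 <= p * (d + 1) <= p * D]. *)
have uD : (size u <= p * D)%N.
  apply: leq_trans uH _; apply: leq_trans (_ : p * (size (H (rVpoly v))).-1.+1 <= _)%N.
    by rewrite mulnS; move: p1; clear; lia.
  by rewrite leq_mul2l vD orbT.
apply/imsetP; exists (poly_rV u, poly_rV k) => //.
by rewrite /f /= !poly_rV_K // -gE rVpolyK.
Qed.

(** Second entries with [deg H < D] are few, and each is allowed all [q ^ N] first entries; any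
    other nonzero second entry leaves only the multiples of its [H], at most [q ^ (N - D)] of
    them. *)
Lemma card_covered_pairs N D p (H : {poly F} -> {poly F}) : (1 < p)%N ->
  (D <= N)%N ->
  (forall g, g != 0 -> H g %| g /\ exists u k,
    g = u * k ^+ p /\ (size u <= (p * (size (H g)).-1).+1)%N) ->
  (#|[set v : 'rV[F]_N * 'rV[F]_N |
      (v.2 != 0%R) && (H (rVpoly v.2) %| rVpoly v.1)%R]|
    <= q ^ (p * D + (N %/ p).+1) * q ^ N + q ^ N * q ^ (N - D))%N.
Proof.
move=> p1 DN HP; set B := [set v | _].
have q0 : (0 < q)%N by apply: ltnW; exact: card_finNzRing_gt1.
set K := [set v : 'rV[F]_N | (v != 0) && ((size (H (rVpoly v))).-1 < D)%N].
have Kle : (#|K| <= q ^ (p * D + (N %/ p).+1))%N.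
  by apply: card_small_powerfree_part => // g /HP[].
apply: leq_trans (_ : \sum_(v2 : 'rV[F]_N) ((v2 \in K) * q ^ N + q ^ (N - D)) <= _)%N;
    last first.
  rewrite big_split /= -big_distrl /= sum_nat_const card_rV leq_add2r.
  by rewrite -big_mkcond /= sum1_card leq_mul2r Kle orbT.
have -> : #|B| = (\sum_v2 \sum_(v1 | (v1, v2) \in B) 1)%N.
  rewrite (exchange_big_dep predT) //= pair_big_dep /= -sum1_card.
  by apply: eq_bigl => -[].
apply: leq_sum => v2 _; rewrite sum1dep_card.
have [v20|v20] := eqVneq v2 0.
  have -> : [set v1 | (v1, v2) \in B] = finset.set0.
    by apply/finset.setP => v1; rewrite !inE /= v20 eqxx.
  by rewrite cards0.
have [v2K|v2K] := boolP (v2 \in K).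
  by rewrite mul1n -card_rV; apply: leq_trans (leq_addr _ _); exact: max_card.
have g0 : rVpoly v2 != 0 by rewrite rVpoly_eq0.
have [Hg _] := HP _ g0.
have H0 : H (rVpoly v2) != 0.
  by apply: contraNneq g0 => H0; rewrite -dvd0p -H0.
have HN : ((size (H (rVpoly v2))).-1 <= N)%N.
  apply: leq_trans (leq_pred _) _; apply: leq_trans (size_rVpoly v2).
  exact: dvdp_leq.
rewrite mul0n add0n.
have -> : [set v1 | (v1, v2) \in B] = [set v1 | H (rVpoly v2) %| rVpoly v1].
  by apply/finset.setP => v1; rewrite !inE /= v20.
rewrite card_multiples_rV // leq_pexp2l // leq_sub2l //.
by move: v2K; rewrite inE v20 /= -leqNgt.
Qed.

(** A pair prime to ['X] lies in [S2] unless it is covered, and then [H] of the second entry divides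
    the first, so [card_covered_pairs] counts it. *)
Lemma card_below_S2_ge N D p : (1 < p)%N -> (0 < N)%N -> (D <= N)%N ->
  ((q ^ N - q ^ N.-1) ^ 2 <= #|` fset_set (below (S2 F p) N)| +
    (q ^ (p * D + (N %/ p).+1) * q ^ N + q ^ N * q ^ (N - D)))%N.
Proof.
move=> p1 N0 DN.
(* One [h] is fixed for each [g]; at [g = 0] its value is arbitrary, since only nonzero second
   entries are counted. *)
have /choice[H HP] : forall g, exists h, g != 0 ->
    [/\ h %| g, forall g1, covers_nondivisible p g g1 -> h %| g1 &
    exists u k, g = u * k ^+ p /\ (size u <= (p * (size h).-1).+1)%N].
  move=> g; have [->|g0] := eqVneq g 0; first by exists 0.
  by have [h ?] := powerfree_decomposition (ltnW p1) g0; exists h.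
rewrite (@card_subset_W2_below N); last by move=> ? [].
rewrite -card_coprimeX_rV // -mulnn -cardsX.
set M := finset.setX _ _; set S := [set v | _].
have BP : forall g, g != 0 -> H g %| g /\ exists u k,
    g = u * k ^+ p /\ (size u <= (p * (size (H g)).-1).+1)%N.
  by move=> g /HP[].
apply: leq_trans (leq_add (leqnn _) (card_covered_pairs p1 DN BP)).
set B := [set v | _].
apply: leq_trans (_ : #|S :|: B| <= _)%N; last first.
  by rewrite -cardsUI leq_addr.
apply/subset_leq_card/fintype.subsetP => v; rewrite !inE => /andP[X1 X2].
have g0 : rVpoly v.2 != 0 by apply: contraNneq X2 => ->; rewrite dvdp0.
have [cov|ncov] := pselect (covers_nondivisible p (rVpoly v.2) (rVpoly v.1)).
  by rewrite -rVpoly_eq0 g0 /=; have [_ -> //] := HP _ g0; rewrite orbT.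
apply/orP; left; apply/asboolP; split; first exact: S2_not_covered.
by apply/W2_belowE; split=> //; exact: size_rVpoly.
Qed.

End Counting.

(** * Choice of the cutoff [D] and passage to the limit *)

Lemma cvg_divn_infty m : (0 < m)%N -> ((n %/ m)%N @[n --> \oo] --> \oo)%classic.
Proof.
move=> m0; apply/cvgnyPge => A; exists (A * m)%N => // n /= Amn.
by rewrite leq_divRL.
Qed.

(** As [p >= 2], the terms [p * D], [N %/ p] and [D] are at most [N/4], [N/2] and [N/8], so they sum
    to at most [N]. Hence the first error term of [card_below_S2_ge] is at most [q] times the
    second. *)
Lemma exponent_bound p N : (1 < p)%N ->
  (p * (N %/ (4 * p)) + (N %/ p).+1 <= (N - N %/ (4 * p)).+1)%N.
Proof.
move=> p1; set D := (N %/ (4 * p))%N; set Q := (N %/ p)%N.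
have hD : (D * (4 * p) <= N)%N by exact: leq_divM.
have hQ : (Q * p <= N)%N by exact: leq_divM.
have h1 : (2 * D <= p * D)%N by rewrite leq_mul2r p1 orbT.
have h2 : (2 * Q <= p * Q)%N by rewrite leq_mul2r p1 orbT.
move: hD hQ h1 h2; rewrite mulnCA [(D * p)%N]mulnC [(Q * p)%N]mulnC.
by move: (p * D)%N (p * Q)%N => a b; lia.
Qed.

Section Density.
Local Open Scope classical_set_scope.
Local Open Scope ring_scope.
Variables (R : realType) (F : finFieldType) (p : nat).
Hypothesis p1 : (1 < p)%N.
Local Notation q := #|F|.
Local Notation x := (q%:R^-1 : R).

Lemma card_F_gt1 : (1 : R) < q%:R.
Proof. by rewrite ltr1n; exact: card_finNzRing_gt1. Qed.

Lemma natr_coprimeX_count N : (0 < N)%N ->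
  ((q ^ N - q ^ N.-1)%N)%:R = q%:R ^+ N * (1 - x) :> R.
Proof.
case: N => // N _; have q1 := card_F_gt1.
rewrite natrB /=; last by rewrite leq_pexp2l // ltnW // card_finNzRing_gt1.
rewrite !natrX exprS mulrBr mulr1 mulrAC mulfV ?mul1r //.
by rewrite gt_eqF // (lt_trans _ q1).
Qed.

(** The counts are divided by [q ^ (2 * N) * (1 - x ^+ N)], which is positive since [N > 0]. The
    error terms total at most [(q + 1) * q ^ (2 * N - D)], whence [(q + 1) * x ^+ D]. *)
Lemma density_ratio_bounds N : (0 < N)%N ->
  ((1 - x) ^+ 2 - (q%:R + 1) * x ^+ (N %/ (4 * p))) / (1 - x ^+ N) <=
  #|` fset_set (below (S2 F p) N)|%:R / #|` fset_set (@W2_below F N)|%:R <=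
  (1 - x) ^+ 2 / (1 - x ^+ N).
Proof.
move=> N0; have q1 := card_F_gt1.
have q0 : (0 : R) < q%:R by exact: lt_trans q1.
have qN0 : (q%:R : R) != 0 by rewrite gt_eqF.
set D := (N %/ (4 * p))%N.
have DN : (D <= N)%N by exact: leq_div.
set S := #|` fset_set (below _ _)|.
set a : R := q%:R ^+ N.
have a0 : 0 < a by exact: exprn_gt0.
have aN0 : a != 0 by rewrite gt_eqF.
have xN1 : 0 < 1 - x ^+ N.
  by rewrite subr_gt0 exprn_ilt1 ?invr_ge0 ?ltW ?invf_lt1 // -lt0n.
have WE : #|` fset_set (@W2_below F N)|%:R = a ^+ 2 * (1 - x ^+ N).
  rewrite card_W2_below natrM natrB; last by rewrite expn_gt0 -(ltr_nat R) q0.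
  by rewrite !natrX exprVn -/a; field.
have Sle : S%:R <= a ^+ 2 * (1 - x) ^+ 2.
  by rewrite -exprMn -natr_coprimeX_count // -natrX ler_nat card_below_S2_le.
have Sge : a ^+ 2 * ((1 - x) ^+ 2 - (q%:R + 1) * x ^+ D) <= S%:R.
  have : (a * (1 - x)) ^+ 2 <= S%:R + a * (q%:R + 1) * q%:R ^+ (N - D).
    rewrite -natr_coprimeX_count // -natrX natr1 /a -!natrX -!natrM -natrD ler_nat.
    apply: leq_trans (card_below_S2_ge _ p1 N0 DN) _; rewrite leq_add2l.
    rewrite -mulnA mulSn mulnDr addnC leq_add2l mulnC leq_mul2l -expnS.
    by rewrite leq_pexp2l ?exponent_bound ?orbT // -(ltr_nat R) q0.
  have -> : q%:R ^+ (N - D) = a * x ^+ D.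
    by rewrite /a -{2}(subnK DN) exprD exprVn mulfK // expf_neq0.
  by move: (x ^+ D) => z; lra.
by rewrite WE invfM mulrA !ler_pM2r ?invr_gt0 // ler_pdivrMr ?ler_pdivlMr
  ?exprn_gt0 // ![_ * a ^+ 2]mulrC Sge.
Qed.

(** Squeeze: [x < 1] in absolute value and both exponents [N] and [N %/ (4 * p)] tend to infinity,
    so both bounds tend to [(1 - x) ^+ 2]. *)
Lemma S2_density : has_density (S2 F p) ((1 - x) ^+ 2).
Proof.
have q1 := card_F_gt1.
have x1 : `|x| < 1.
  by rewrite ger0_norm ?invr_ge0 ?ler0n // invf_lt1 // (lt_trans _ q1).
have xN : (x ^+ N @[N --> \oo] --> 0)%classic by exact: cvg_expr.
have p4 : (0 < 4 * p)%N by rewrite muln_gt0 (ltnW p1).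
have xD : (x ^+ (N %/ (4 * p)) @[N --> \oo] --> 0)%classic.
  exact: cvg_comp (cvg_divn_infty p4) xN.
have den : ((1 - x ^+ N)^-1 @[N --> \oo] --> (1 : R))%classic.
  rewrite -[1 in X in _ --> X]invr1; apply: cvgV; first exact: oner_neq0.
  by rewrite -[1 in X in _ --> X]subr0; apply: cvgB => //; exact: cvg_cst.
apply: squeeze_cvgr.
- near=> N; apply: density_ratio_bounds; near: N; exact: nbhs_infty_gt.
- rewrite -[X in _ --> X]mulr1; apply: cvgM => //.
  rewrite -[X in _ --> X]subr0 -(mulr0 (q%:R + 1 : R)).
  by apply: cvgB; [exact: cvg_cst | apply: cvgMr; exact: xD].
- by rewrite -[X in _ --> X]mulr1; apply: cvgM => //; exact: cvg_cst.
Unshelve. all: by end_near.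
Qed.

End Density.

Theorem theorem4p6 (R : realType) (q p : nat) (F : finFieldType)
  (hq4 : (4 <= q)%N) (hq : #|F| = q) (hp : p \in [pchar F]) :
  has_density (S2 F p) ((1 - q%:R^-1) ^+ 2 : R).
Proof.
by rewrite -hq; apply: S2_density; exact: prime_gt1 (pcharf_prime hp).
Qed.
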